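(* Let $\mathcal{M}$ be a compact manifold of dimension $N_d$, let $\mathbf{f}:\mathcal{M}\to\mathcal{M}$ be a map, and consider the discrete-time dynamical system $\mathbf{x}_{n+1}=\mathbf{f}(\mathbf{x}_n)$, $n\in\mathbb{N}\cup\{0\}$, on $\mathcal{M}$. Let $\mathcal{F}$ be a Banach space of complex-valued functions on $\mathcal{M}$ on which the Koopman operator $\mathcal{K}:\mathcal{F}\to\mathcal{F}$, $\mathcal{K}\psi=\psi\circ\mathbf{f}$, is defined. Let $\Psi_e=[\psi_1,\ldots,\psi_{N_l}]^{\top}\in\mathcal{F}^{N_l}$ be a vector-valued function (encoder) $\Psi_e:\mathcal{M}\to\mathbb{R}^{N_l}$ whose components are real-valued functions $\psi_i\in\mathcal{F}$, and let $\mathcal{G}=\operatorname{span}_{\mathbb{R}}\{\psi_1,\ldots,\psi_{N_l}\}$. Then $\mathcal{G}$ is a Koopman invariant subspace with respect to the dynamics $\mathbf{x}_{n+1}=\mathbf{f}(\mathbf{x}_n)$ if and only if there exists a matrix $K\in\mathbb{R}^{N_l\times N_l}$ such that for every initial condition $\mathbf{x}_0\in\mathcal{M}$, with trajectory $\mathbf{x}_{n+1}=\mathbf{f}(\mathbf{x}_n)$, $$\Psi_e(\mathbf{x}_{n+k})=K^{k}\,\Psi_e(\mathbf{x}_n)\qquad\text{for all integers } n\ge 0 \text{ and } k\ge 1.$$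
   Context: The Koopman operator of $\mathbf{f}$ is the linear operator $\mathcal{K}:\mathcal{F}\to\mathcal{F}$ given by $\mathcal{K}\psi=\psi\circ\mathbf{f}$; it is a standing assumption that $\mathcal{K}$ maps $\mathcal{F}$ into itself, i.e. $\psi\circ\mathbf{f}\in\mathcal{F}$ for all $\psi\in\mathcal{F}$. A linear subspace $\mathcal{G}\subseteq\mathcal{F}$ is called Koopman invariant if $\mathcal{K}\mathcal{G}\subseteq\mathcal{G}$, i.e. $g\circ\mathbf{f}\in\mathcal{G}$ for every $g\in\mathcal{G}$. The number $N_l\ge 1$ is an integer (latent dimension). The matrix $K$ does not depend on $\mathbf{x}_0$, $n$ or $k$. *)

(* Defs.v *)
(* MathComp-Analysis, with R[i] from mathcomp-real-closed *)
From HB Require Import structures.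
From mathcomp Require Import all_boot all_order all_algebra.
From mathcomp Require Import all_classical all_reals all_analysis.
From mathcomp Require Import complex.

Set Implicit Arguments.
Unset Strict Implicit.
Unset Printing Implicit Defensive.

Import Order.TTheory GRing.Theory Num.Theory numFieldNormedType.Exports.

Local Open Scope classical_set_scope.
Local Open Scope ring_scope.
Local Open Scope complex_scope.

(* phi restricts to a homeomorphism from U onto V, with inverse phi'; the
   values of phi outside U and of phi' outside V are irrelevant. *)
Definition homeo_between (S T : topologicalType) (U : set S) (V : set T)
    (phi : S -> T) (phi' : T -> S) : Prop :=
  [/\ phi @` U `<=` V, phi' @` V `<=` U,
      {within U, continuous phi}, {within V, continuous phi'}
    & (forall p, U p -> phi' (phi p) = p) /\
      (forall q, V q -> phi (phi' q) = q)].

Definition locally_euclidean (R : realType) (d : nat) (M : topologicalType)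
    : Prop :=
  forall p : M, exists (U : set M) (V : set 'rV[R]_d)
    (phi : M -> 'rV[R]_d) (phi' : 'rV[R]_d -> M),
    [/\ open U, U p, open V & homeo_between U V phi phi'].

(* No smooth structure is imposed and the boundary is empty. *)
Definition compact_manifold (R : realType) (d : nat) (M : topologicalType)
    : Prop :=
  [/\ hausdorff_space M, @second_countable M, locally_euclidean R d M
    & compact [set: M]].

(* A Banach space of complex-valued functions on M is represented by an
   abstract complex Banach space F and an injective linear map ev sending each
   element of F to the function it stands for.  The norm of F is unrelated to
   the values of the functions: evaluations need not be continuous. *)
Definition koopman_operator (R : realType) (M : Type)
    (F : completeNormedModType R[i]) (ev : {linear F -> (M -> R[i]^o)})
    (f : M -> M) (Koop : F -> F) : Prop :=
  forall g : F, ev (Koop g) = ev g \o f.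

Definition real_subspace (R : realType) (F : lmodType R[i]) (G : set F)
    : Prop :=
  G 0 /\ forall (a : R) (u v : F), G u -> G v -> G (a%:C *: u + v).

Definition real_span (R : realType) (F : lmodType R[i]) (n : nat)
    (psi : 'I_n -> F) : set F :=
  [set g | exists c : 'I_n -> R, g = \sum_(i < n) (c i)%:C *: psi i].

Definition koopman_invariant_subspace (R : realType) (F : lmodType R[i])
    (Koop : F -> F) (G : set F) : Prop :=
  real_subspace G /\ Koop @` G `<=` G.

(* Psi is the map M -> R^n whose components are the elements psi i of F; in
   particular each psi i is a real-valued function. *)
Definition encoder_of (R : realType) (M : Type)
    (F : completeNormedModType R[i]) (ev : {linear F -> (M -> R[i]^o)})
    (n : nat) (psi : 'I_n -> F) (Psi : M -> 'cV[R]_n) : Prop :=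
  forall (i : 'I_n) (x : M), ev (psi i) x = (Psi x i ord0)%:C.

Definition trajectory (M : Type) (f : M -> M) (x0 : M) (x : nat -> M) : Prop :=
  x 0%N = x0 /\ forall n : nat, x n.+1 = f (x n).

(* Main.v *)
(* Both sides say that some real matrix K satisfies Psi (f x) = K Psi x for all
   x.  Row i of this identity is the evaluation at x of
   Koop psi_i = sum_j K_ij psi_j, an identity in F since ev is injective, so K
   collects the coefficients of the Koop psi_i.  The psi_i may be linearly
   dependent, hence K is chosen rather than determined. *)
Require Import Defs.
From HB Require Import structures.
From mathcomp Require Import all_boot all_order all_algebra.
From mathcomp Require Import all_classical all_reals all_analysis.
From mathcomp Require Import complex.
Import Order.TTheory GRing.Theory Num.Theory numFieldNormedType.Exports.
Local Open Scope classical_set_scope.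
Local Open Scope ring_scope.

Set Implicit Arguments.
Unset Strict Implicit.
Unset Printing Implicit Defensive.

Lemma real_span_subspace (R : realType) (F : lmodType R[i]) (n : nat)
  (psi : 'I_n -> F) : real_subspace (real_span psi).
Proof.
split=> [|a u v [c ->] [d ->]].
  by exists (fun=> 0); rewrite big1// => i _; rewrite scale0r.
exists (fun i => a * c i + d i); rewrite scaler_sumr -big_split/=.
by apply: eq_bigr => i _; rewrite rmorphD rmorphM/= scalerDl scalerA.
Qed.

Lemma mem_real_span (R : realType) (F : lmodType R[i]) (n : nat)
  (psi : 'I_n -> F) (i : 'I_n) : real_span psi (psi i).
Proof.
exists (fun j => (j == i)%:R); rewrite (bigD1 i)//= eqxx scale1r.
by rewrite big1 ?addr0// => j /negPf ->; rewrite scale0r.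
Qed.

(** [ev] is complex linear and the embedding of the reals is a ring morphism, so real coefficients
    keep the values real. This turns identities in [F] into identities between real vectors. *)
Lemma ev_real_comb (R : realType) (M : Type) (F : completeNormedModType R[i])
  (ev : {linear F -> (M -> R[i]^o)}) (n : nat) (psi : 'I_n -> F)
  (Psi : M -> 'cV[R]_n) (c : 'I_n -> R) (x : M) : encoder_of ev psi Psi ->
  ev (\sum_(i < n) (c i)%:C%C *: psi i) x
  = (\sum_(i < n) c i * Psi x i ord0)%:C%C.
Proof.
move=> hPsi; rewrite linear_sum/= fct_sumE rmorph_sum/=.
by apply: eq_bigr => i _; rewrite linearZ/= rmorphM/= -hPsi.
Qed.

(** Linearity of [Koop] is derived, not assumed: composition with [f] is linear on functions, and
    injectivity of [ev] carries this back to [F]. *)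
Lemma koopman_real_comb (R : realType) (M : Type)
  (F : completeNormedModType R[i]) (ev : {linear F -> (M -> R[i]^o)})
  (f : M -> M) (Koop : F -> F) (n : nat) (psi : 'I_n -> F) (c : 'I_n -> R) :
  injective ev -> koopman_operator ev f Koop ->
  Koop (\sum_(i < n) (c i)%:C%C *: psi i)
  = \sum_(i < n) (c i)%:C%C *: Koop (psi i).
Proof.
move=> ev_inj hKoop; apply: ev_inj; apply/funext => x.
rewrite hKoop/= !linear_sum/= !fct_sumE.
by apply: eq_bigr => i _; rewrite !linearZ/= hKoop.
Qed.

Lemma koopman_matrixP (R : realType) (M : Type)
  (F : completeNormedModType R[i]) (ev : {linear F -> (M -> R[i]^o)})
  (f : M -> M) (Koop : F -> F) (n : nat) (psi : 'I_n -> F)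
  (Psi : M -> 'cV[R]_n) (K : 'M[R]_n) :
  injective ev -> koopman_operator ev f Koop -> encoder_of ev psi Psi ->
  (forall i, Koop (psi i) = \sum_(j < n) (K i j)%:C%C *: psi j) <->
  (forall x, Psi (f x) = K *m Psi x).
Proof.
move=> ev_inj hKoop hPsi.
have evK i x : ev (Koop (psi i)) x = (Psi (f x) i ord0)%:C%C.
  by rewrite hKoop/= hPsi.
split=> [KpsiE x|PsiE i].
  (* Real entries are compared through their images in [R[i]], where [ev] takes its values. *)
  apply/colP => i; rewrite mxE; apply: (@complexI R).
  by rewrite -evK KpsiE (ev_real_comb _ _ hPsi).
apply: ev_inj; apply/funext => x.
by rewrite evK PsiE mxE (ev_real_comb _ _ hPsi).
Qed.

(** Invariance need only be tested on the generators, because [Koop] commutes with real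
    combinations. *)
Lemma koopman_invariant_spanP (R : realType) (M : Type)
  (F : completeNormedModType R[i]) (ev : {linear F -> (M -> R[i]^o)})
  (f : M -> M) (Koop : F -> F) (n : nat) (psi : 'I_n -> F) :
  injective ev -> koopman_operator ev f Koop ->
  koopman_invariant_subspace Koop (real_span psi) <->
  exists K : 'M[R]_n,
    forall i, Koop (psi i) = \sum_(j < n) (K i j)%:C%C *: psi j.
Proof.
move=> ev_inj hKoop; split=> [[_ KG]|[K KpsiE]].
  have /choice[c cE] i :
      exists c : 'I_n -> R, Koop (psi i) = \sum_(j < n) (c j)%:C%C *: psi j.
    by apply: KG; exists (psi i) => //; exact: mem_real_span.
  exists (\matrix_(i, j) c i j) => i.
  by rewrite cE; apply: eq_bigr => j _; rewrite mxE.
split=> [|_ [_ [c ->] <-]]; first exact: real_span_subspace.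
(* The new coefficients form the row vector [c] times [K], as exchanging the two sums shows. *)
exists (fun j => \sum_(i < n) c i * K i j).
rewrite (koopman_real_comb _ _ ev_inj hKoop).
under eq_bigr do rewrite KpsiE scaler_sumr.
rewrite exchange_big/=; apply: eq_bigr => j _.
rewrite rmorph_sum scaler_suml; apply: eq_bigr => i _.
by rewrite rmorphM/= scalerA.
Qed.

Lemma trajectory_iter (M : Type) (f : M -> M) (x : M) :
  trajectory f x (fun n => iter n f x).
Proof. by []. Qed.

Lemma trajectory_matrixP (R : realType) (M : Type) (f : M -> M) (n : nat)
  (Psi : M -> 'cV[R]_n) (K : 'M[R]_n) :
  (forall x, Psi (f x) = K *m Psi x) <->
  forall (x0 : M) (x : nat -> M), trajectory f x0 x ->
  forall m k : nat, (1 <= k)%N -> Psi (x (m + k)%N) = (K ^+ k) *m Psi (x m).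
Proof.
split=> [PsiE x0 x [_ xS] m k _|PsiE x].
  (* The induction starts at [k = 0], where [K ^+ 0] is the identity. *)
  elim: k => [|k IH]; first by rewrite addn0 expr0 mul1mx.
  by rewrite addnS xS PsiE IH mulmxA exprS.
(* Every point starts a trajectory, its orbit under [f]; times 0 and 1 on it give the one-step
   identity. *)
by have := PsiE _ _ (trajectory_iter f x) 0%N 1%N isT; rewrite expr1.
Qed.

Theorem theorem1 (R : realType) (Nd : nat) (M : topologicalType)
  (hM : compact_manifold R Nd M) (f : M -> M)
  (F : completeNormedModType R[i])
  (ev : {linear F -> (M -> R[i]^o)}) (ev_inj : injective ev)
  (Koop : F -> F) (hKoop : koopman_operator ev f Koop)
  (Nl : nat) (hNl : (1 <= Nl)%N)
  (psi : 'I_Nl -> F) (Psi : M -> 'cV[R]_Nl) (hPsi : encoder_of ev psi Psi) :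
  koopman_invariant_subspace Koop (real_span psi) <->
  exists K : 'M[R]_Nl,
    forall (x0 : M) (x : nat -> M), trajectory f x0 x ->
    forall n k : nat, (1 <= k)%N -> Psi (x (n + k)%N) = (K ^+ k) *m Psi (x n).
Proof.
have matrixP := koopman_matrixP _ ev_inj hKoop hPsi.
apply: (iff_trans (koopman_invariant_spanP _ ev_inj hKoop)).
split=> -[K KE]; exists K.
  by apply/trajectory_matrixP; apply/matrixP.
by apply/matrixP; apply/trajectory_matrixP.
Qed.
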